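(* Suppose that $P(r,n,k,s,q)^{\mathrm{ab}}\cong\mathbb{Z}$ (which holds, in particular, if $P(r,n,k,s,q)$ is a connected LOG group), where $n\geq 1$, $0\leq k,q<n$, $r,s\geq 1$ and $r\neq s$. Then $n$ is even, $\gcd(n,k-1,q)=1$, $|r-s|=2$, $q$ is odd, $P(r,c,k,s,q)^{\mathrm{ab}}\cong\mathbb{Z}_2$ for the largest odd divisor $c$ of $n$, and either (i) $s$ is even; or (ii) $s$ is odd and $k$ is odd.
   Context: The Prishchepov group $P(r,n,k,s,q)$ is the group with presentation \[P(r,n,k,s,q)=\left\langle x_0,\ldots,x_{n-1}\ \middle|\ \prod_{j=0}^{r-1}x_{i+qj}=\prod_{j=0}^{s-1}x_{i+qj+(k-1)}\ (0\leq i<n)\right\rangle,\] where subscripts are taken modulo $n$ and products are in order of increasing $j$. In $P(r,c,k,s,q)$ subscripts are taken modulo $c$ (so $k$ and $q$ may be reduced modulo $c$). $G^{\mathrm{ab}}$ denotes the abelianisation of $G$, and $\mathbb{Z}_2$ is the cyclic group of order $2$. A connected LOG group is a group with a presentation $\langle V\mid \tau(e)^{-1}\lambda(e)^{-1}\iota(e)\lambda(e)\ (e\in E)\rangle$ arising from a finite connected graph (loops and multiple edges allowed) with vertex set $V$ and edge set $E$ and maps $\iota,\tau,\lambda:E\to V$ giving the initial vertex, terminal vertex and label of each edge. *)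

(* Defs.v *)
From HB Require Import structures.
From mathcomp Require Import all_boot all_order all_algebra.
From mathcomp Require Import boolp.

Set Implicit Arguments.
Unset Strict Implicit.
Unset Printing Implicit Defensive.

Import GRing.Theory.

Local Open Scope quotient_scope.

(* Words over X: the letter (x, false) stands for x and (x, true) for x^-1. *)
Definition word (X : Type) : Type := seq (X * bool).

Definition gen {X : Type} (x : X) : X * bool := (x, false).
Definition gen_inv {X : Type} (x : X) : X * bool := (x, true).

Definition word_inv {X : Type} (w : word X) : word X :=
  rev [seq (a.1, ~~ a.2) | a <- w].

(* The congruence on words that defines < X | u = v for (u, v) in rels >:
   [rels u v] says that u = v is one of the defining relations. *)
Inductive pres_eq (X : Type) (rels : word X -> word X -> Prop) :
    word X -> word X -> Prop :=
| pres_rel u v : rels u v -> pres_eq rels u v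
| pres_cancel x b : pres_eq rels [:: (x, b); (x, ~~ b)] [::]
| pres_refl u : pres_eq rels u u
| pres_sym u v : pres_eq rels u v -> pres_eq rels v u
| pres_trans u v w : pres_eq rels u v -> pres_eq rels v w -> pres_eq rels u w
| pres_cat u u' v v' : pres_eq rels u u' -> pres_eq rels v v' ->
    pres_eq rels (u ++ v) (u' ++ v').

Section PresentedGroup.
Variables (X : choiceType) (rels : word X -> word X -> Prop).

Definition pres_eqb (u v : seq (X * bool)) : bool := `[< pres_eq rels u v >].

Lemma pres_eqb_refl : reflexive pres_eqb.
Proof. by move=> u; apply/asboolP; apply: pres_refl. Qed.

Lemma pres_eqb_sym : symmetric pres_eqb.
Proof. by move=> u v; apply/asboolP/asboolP; apply: pres_sym. Qed.

Lemma pres_eqb_trans : transitive pres_eqb.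
Proof.
move=> v u w /asboolP uv /asboolP vw; apply/asboolP.
exact: pres_trans uv vw.
Qed.

Canonical pres_equiv :=
  EquivRel pres_eqb pres_eqb_refl pres_eqb_sym pres_eqb_trans.

Definition presented_group : Type := {eq_quot pres_equiv}.

HB.instance Definition _ := Choice.on presented_group.

Definition class_of_word (w : word X) : presented_group :=
  \pi_{eq_quot pres_equiv} w.

Definition word_of_class (g : presented_group) : word X :=
  repr (g : {eq_quot pres_equiv}).

Lemma word_of_classK : cancel word_of_class class_of_word.
Proof. by move=> g; apply: (@reprK _ {eq_quot pres_equiv}). Qed.

Lemma class_of_wordP u v :
  class_of_word u = class_of_word v <-> pres_eq rels u v.
Proof.
split=> [/(@eqmodP _ pres_equiv)/asboolP //|uv].
by apply/(@eqmodP _ pres_equiv)/asboolP.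
Qed.

Lemma pres_word_of_class u : pres_eq rels (word_of_class (class_of_word u)) u.
Proof. by apply/class_of_wordP; rewrite word_of_classK. Qed.

Lemma pres_cancel_cons x b w : pres_eq rels [:: (x, b), (x, ~~ b) & w] w.
Proof.
exact: (@pres_cat _ _ [:: (x, b); (x, ~~ b)] [::] w w (pres_cancel _ x b)
                  (pres_refl _ w)).
Qed.

Lemma word_invK : involutive (@word_inv X).
Proof.
move=> w; rewrite /word_inv map_rev revK -map_comp -[RHS]map_id.
by apply: eq_map => -[x b] /=; rewrite negbK.
Qed.

Lemma pres_inv_l w : pres_eq rels (word_inv w ++ w) [::].
Proof.
elim: w => [|[x b] w IHw]; first exact: pres_refl.
rewrite /word_inv /= rev_cons cat_rcons.
apply: pres_trans IHw; apply: pres_cat; first exact: pres_refl.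
by have := pres_cancel_cons x (~~ b) w; rewrite negbK.
Qed.

Lemma pres_inv_r w : pres_eq rels (w ++ word_inv w) [::].
Proof. by rewrite -{1}[w]word_invK; apply: pres_inv_l. Qed.

Lemma pres_inv u v : pres_eq rels u v ->
  pres_eq rels (word_inv u) (word_inv v).
Proof.
move=> uv.
have : pres_eq rels (word_inv u ++ (v ++ word_inv v)) (word_inv u).
  rewrite -[X in pres_eq _ _ X]cats0.
  by apply: pres_cat; [apply: pres_refl | apply: pres_inv_r].
move/pres_sym/pres_trans; apply; rewrite catA -[X in pres_eq _ _ X]cat0s.
apply: pres_cat; last exact: pres_refl.
apply: pres_trans (pres_inv_l u); apply: pres_cat; first exact: pres_refl.
exact: pres_sym.
Qed.

Definition pres_mul (g h : presented_group) : presented_group :=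
  class_of_word (word_of_class g ++ word_of_class h).
Definition pres_one : presented_group := class_of_word [::].
Definition pres_invg (g : presented_group) : presented_group :=
  class_of_word (word_inv (word_of_class g)).

Lemma pres_mulE u v :
  pres_mul (class_of_word u) (class_of_word v) = class_of_word (u ++ v).
Proof.
by apply/class_of_wordP; apply: pres_cat; apply: pres_word_of_class.
Qed.

Lemma pres_invgE u : pres_invg (class_of_word u) = class_of_word (word_inv u).
Proof. by apply/class_of_wordP/pres_inv/pres_word_of_class. Qed.

Lemma pres_mulA : associative pres_mul.
Proof.
move=> g h l.
rewrite -[g]word_of_classK -[h]word_of_classK -[l]word_of_classK.
by rewrite !pres_mulE catA.
Qed.

Lemma pres_mul1g : left_id pres_one pres_mul.
Proof. by move=> g; rewrite -[g]word_of_classK pres_mulE. Qed.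

Lemma pres_mulg1 : right_id pres_one pres_mul.
Proof. by move=> g; rewrite -[g]word_of_classK pres_mulE cats0. Qed.

Lemma pres_mulVg : left_inverse pres_one pres_invg pres_mul.
Proof.
move=> g; rewrite -[g]word_of_classK pres_invgE pres_mulE.
exact/class_of_wordP/pres_inv_l.
Qed.

Lemma pres_mulgV : right_inverse pres_one pres_invg pres_mul.
Proof.
move=> g; rewrite -[g]word_of_classK pres_invgE pres_mulE.
exact/class_of_wordP/pres_inv_r.
Qed.

HB.instance Definition _ := isGroup.Build presented_group
  pres_mulA pres_mul1g pres_mulg1 pres_mulVg pres_mulgV.

End PresentedGroup.

Section Abelianisation.
Variable G : groupType.
Local Open Scope group_scope.

Inductive derived_subgroup : G -> Prop :=
| derived_one : derived_subgroup 1
| derived_comm (x y : G) : derived_subgroup (commg x y)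
| derived_mul (x y : G) :
    derived_subgroup x -> derived_subgroup y -> derived_subgroup (x * y)
| derived_inv (x : G) : derived_subgroup x -> derived_subgroup x^-1.

Definition derived_eqb (x y : G) : bool := `[< derived_subgroup (x^-1 * y) >].

Lemma derived_eqb_refl : reflexive derived_eqb.
Proof. by move=> x; apply/asboolP; rewrite mulVg; apply: derived_one. Qed.

Lemma derived_eqb_sym : symmetric derived_eqb.
Proof.
by move=> x y; apply/asboolP/asboolP=> /derived_inv; rewrite invgM invgK.
Qed.

Lemma derived_eqb_trans : transitive derived_eqb.
Proof.
move=> y x z /asboolP xy /asboolP yz; apply/asboolP.
by have := derived_mul xy yz; rewrite mulgA mulgK.
Qed.

Canonical derived_equiv :=
  EquivRel derived_eqb derived_eqb_refl derived_eqb_sym derived_eqb_trans.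

Definition abelianisation : Type := {eq_quot derived_equiv}.

HB.instance Definition _ := Choice.on abelianisation.

Definition ab_proj (x : G) : abelianisation :=
  \pi_{eq_quot derived_equiv} x.

Definition ab_repr (a : abelianisation) : G :=
  repr (a : {eq_quot derived_equiv}).

Lemma ab_reprK : cancel ab_repr ab_proj.
Proof. by move=> a; apply: (@reprK _ {eq_quot derived_equiv}). Qed.

Lemma ab_projP (x y : G) :
  ab_proj x = ab_proj y <-> derived_subgroup (x^-1 * y).
Proof.
split=> [/(@eqmodP _ derived_equiv)/asboolP //|xy].
by apply/(@eqmodP _ derived_equiv)/asboolP.
Qed.

Lemma derived_conj (x y : G) : derived_subgroup x -> derived_subgroup (x ^ y).
Proof.
move=> dx; have -> : x ^ y = x * commg x y by rewrite commgEl mulVKg.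
by apply: derived_mul => //; apply: derived_comm.
Qed.

Definition ab_add (a b : abelianisation) := ab_proj (ab_repr a * ab_repr b).
Definition ab_zero : abelianisation := ab_proj 1.
Definition ab_opp (a : abelianisation) := ab_proj (ab_repr a)^-1.

Lemma ab_addE (x y : G) : ab_add (ab_proj x) (ab_proj y) = ab_proj (x * y).
Proof.
apply/ab_projP; set x' := ab_repr _; set y' := ab_repr _.
have /ab_projP dx : ab_proj x' = ab_proj x by rewrite ab_reprK.
have /ab_projP dy : ab_proj y' = ab_proj y by rewrite ab_reprK.
have -> : (x' * y')^-1 * (x * y) = (x'^-1 * x) ^ y' * (y'^-1 * y).
  by rewrite /conjg invgM !mulgA mulgK.
by apply: derived_mul => //; apply: derived_conj.
Qed.

Lemma ab_oppE (x : G) : ab_opp (ab_proj x) = ab_proj x^-1.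
Proof.
apply/ab_projP; set x' := ab_repr _.
have /ab_projP/derived_inv dx : ab_proj x' = ab_proj x by rewrite ab_reprK.
have -> : x'^-1^-1 * x^-1 = (x'^-1 * x)^-1 ^ x'^-1.
  by rewrite /conjg invgM !invgK !mulgA mulgK.
exact: derived_conj.
Qed.

Lemma ab_addA : associative ab_add.
Proof.
move=> a b c; rewrite -[a]ab_reprK -[b]ab_reprK -[c]ab_reprK.
by rewrite !ab_addE mulgA.
Qed.

Lemma ab_addC : commutative ab_add.
Proof.
move=> a b; rewrite -[a]ab_reprK -[b]ab_reprK !ab_addE.
apply/ab_projP; set x := ab_repr a; set y := ab_repr b.
have -> : (x * y)^-1 * (y * x) = commg y x.
  by rewrite invgM /commg /conjg !mulgA.
exact: derived_comm.
Qed.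

Lemma ab_add0 : left_id ab_zero ab_add.
Proof. by move=> a; rewrite -[a]ab_reprK ab_addE mul1g. Qed.

Lemma ab_addN : left_inverse ab_zero ab_opp ab_add.
Proof. by move=> a; rewrite -[a]ab_reprK ab_oppE ab_addE mulVg. Qed.

HB.instance Definition _ := GRing.isZmodule.Build abelianisation
  ab_addA ab_addC ab_add0 ab_addN.

End Abelianisation.

Definition group_iso (G H : groupType) : Prop :=
  exists f : {multiplicative G -> H}, bijective f.

Definition zmod_iso (A B : zmodType) : Prop :=
  exists f : {additive A -> B}, bijective f.

Section Prishchepov.
Variable n : nat.
Local Open Scope ring_scope.

Lemma subscript_subproof (i : 'I_n) (z : int) :
  (`|((i%:Z + z) %% n%:Z)%Z| < n)%N.
Proof.
have n0 : n%:Z != 0 by rewrite -lt0n; case: i => m; apply: leq_ltn_trans.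
by rewrite -ltz_nat gez0_abs ?modz_ge0 // ltz_mod.
Qed.

Definition subscript (i : 'I_n) (z : int) : 'I_n :=
  Ordinal (subscript_subproof i z).

Definition prishchepov_rels (r k s q : nat) (u v : word 'I_n) : Prop :=
  exists i : 'I_n,
    u = [seq gen (subscript i (q%:Z * j%:Z)) | j <- iota 0 r] /\
    v = [seq gen (subscript i (q%:Z * j%:Z + (k%:Z - 1))) | j <- iota 0 s].

End Prishchepov.

Definition prishchepov (r n k s q : nat) : groupType :=
  presented_group (@prishchepov_rels n r k s q).

Record log_graph := LogGraph {
  log_vertex : finType;
  log_edge : finType;
  log_initial : log_edge -> log_vertex;
  log_terminal : log_edge -> log_vertex;
  log_label : log_edge -> log_vertex
}.

(* Adjacency ignores the orientation of the edges and the labels. *)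
Definition log_adj (L : log_graph) : rel (log_vertex L) :=
  fun u v => [exists e : log_edge L,
    ((log_initial e == u) && (log_terminal e == v)) ||
    ((log_initial e == v) && (log_terminal e == u))].

(* The empty graph is not counted as connected. *)
Definition log_connected (L : log_graph) : Prop :=
  (0 < #|log_vertex L|)%N /\ forall u v, connect (@log_adj L) u v.

Definition log_rels (L : log_graph) (u v : word (log_vertex L)) : Prop :=
  exists e : log_edge L,
    u = [:: gen_inv (log_terminal e); gen_inv (log_label e);
            gen (log_initial e); gen (log_label e)] /\
    v = [::].

Definition log_group (L : log_graph) : groupType :=
  presented_group (@log_rels L).

Definition connected_log_group (G : groupType) : Prop :=
  exists L : log_graph, log_connected L /\ group_iso G (log_group L).

Definition largest_odd_divisor (n : nat) : nat :=
  \max_(d <- divisors n | odd d) d.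

(* Main.v *)
(* The cyclic shift of the generators acts on the abelianisation A as an
   automorphism of finite order.  If A = Z it is therefore 1 or -1; it is not 1,
   since otherwise the relation (r - s) x_0 = 0 would make A finite.  So
   x_(i+1) = - x_i in A, and this must persist in every quotient of A:
   A -> Z/|r - s| with x_i |-> 1 forces |r - s| to divide 2, A -> Z/2 with
   x_i |-> [d | i], d = gcd(n, k - 1, q), forces d = 1, and
   P(r,n,k,s,q)^ab -> P(r,c,k,s,q)^ab with c odd gives 2 x_0 = 0 there.
   The parities come from evaluating the relations at x_i = (-1)^i. *)

From HB Require Import structures.
Require Import Defs.
From mathcomp Require Import all_boot all_order all_algebra.
From mathcomp Require Import zify.

Import GRing.Theory.

Local Open Scope ring_scope.

(** * Homomorphisms out of an abelianisation *)

Lemma ex_additive (U V : zmodType) (f : U -> V) :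
  {morph f : x y / x + y} -> exists h : {additive U -> V}, h =1 f.
Proof.
move=> fD.
have f0 : f 0 = 0 by apply: (@addrI _ (f 0)); rewrite -fD !addr0.
have fB : {morph f : x y / x - y}.
  by move=> x y; apply: (addIr (f y)); rewrite -fD !subrK.
pose m := GRing.isZmodMorphism.Build U V f fB.
pose h : {additive U -> V} := HB.pack f m.
by exists h.
Qed.

Section AbelianisationLift.
Variable G : groupType.

Lemma ab_projM (x y : G) : ab_proj (x * y)%g = ab_proj x + ab_proj y.
Proof. by rewrite -ab_addE. Qed.

Lemma ab_projV (x : G) : ab_proj x^-1%g = - ab_proj x.
Proof. by rewrite -ab_oppE. Qed.

(** Universal property of the abelianisation: [B] is commutative, so [f] kills commutators and hence
    the derived subgroup. Its value on [ab_repr a] therefore does not depend on the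
    representative. *)
Lemma ab_lift (B : zmodType) (f : G -> B) :
    (forall x y, f (x * y)%g = f x + f y) ->
  exists h : {additive abelianisation G -> B}, forall x, h (ab_proj x) = f x.
Proof.
move=> fM.
have f1 : f 1%g = 0 by apply: (@addrI _ (f 1%g)); rewrite -fM mul1g addr0.
have fV x : f x^-1%g = - f x.
  by apply: (@addIr _ (f x)); rewrite -fM mulVg f1 addNr.
have fd x : derived_subgroup x -> f x = 0.
  elim=> [||{}x y _ fx _ fy|{}x _ fx] //.
  - move=> x' y; rewrite /commg /conjg !fM !fV.
    by rewrite [in X in _ + X]addrCA addNr addr0 addNr.
  - by rewrite fM fx fy addr0.
  - by rewrite fV fx oppr0.
have fproj x y : ab_proj x = ab_proj y -> f x = f y.
  by move=> /ab_projP /fd; rewrite fM fV => /eqP;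
    rewrite addrC subr_eq0 => /eqP.
have [|h hE] := @ex_additive _ B (fun a : abelianisation G => f (ab_repr a)).
  move=> a b /=; rewrite -fM; apply: fproj.
  by rewrite ab_projM !ab_reprK.
by exists h => x; rewrite hE; apply: fproj; rewrite ab_reprK.
Qed.

End AbelianisationLift.

Lemma group_iso_ab (G H : groupType) :
  group_iso G H -> zmod_iso (abelianisation G) (abelianisation H).
Proof.
case=> f [g fK gK].
have gM : {morph g : x y / (x * y)%g} by apply: can2_gmulfM fK gK.
have [|F FE] := @ab_lift G (abelianisation H) (fun x => ab_proj (f x)).
  by move=> x y; rewrite gmulfM ab_projM.
have [|F' FE'] := @ab_lift H (abelianisation G) (fun x => ab_proj (g x)).
  by move=> x y; rewrite gM ab_projM.
exists F; exists F' => a; rewrite -[a]ab_reprK.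
  by rewrite FE FE' fK.
by rewrite FE' FE gK.
Qed.

Lemma zmod_iso_trans (A B C : zmodType) :
  zmod_iso A B -> zmod_iso B C -> zmod_iso A C.
Proof.
case=> f fb [g gb]; have [|h hE] := @ex_additive A C (g \o f).
  by move=> x y; rewrite /= !raddfD.
by exists h; apply: (eq_bij (bij_comp gb fb)) => x; rewrite hE.
Qed.

(** * Abelianisation of a group given by generators and relations *)

(** The homomorphism from the free group on [X] to [B] that extends [phi], evaluated on words. *)
Definition word_sum (X : Type) (B : zmodType) (phi : X -> B) (w : word X) : B :=
  \sum_(a <- w) (if a.2 then - phi a.1 else phi a.1).

Lemma word_sum_gens (X I : Type) (B : zmodType) (phi : X -> B) (f : I -> X)
    (t : seq I) :
  word_sum _ _ phi [seq gen (f i) | i <- t] = \sum_(i <- t) phi (f i).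
Proof. by rewrite /word_sum big_map. Qed.

Section PresentedAbelianisation.
Variables (X : choiceType) (rels : word X -> word X -> Prop).

Definition ab_gen (x : X) : abelianisation (presented_group rels) :=
  ab_proj (class_of_word rels [:: gen x]).

Lemma ab_proj_word w : ab_proj (class_of_word rels w) = word_sum _ _ ab_gen w.
Proof.
elim: w => [|[x b] w IHw]; first by rewrite /word_sum big_nil.
rewrite -cat1s -pres_mulE [LHS]ab_projM IHw /word_sum big_cat big_seq1 /=.
congr (_ + _); case: b => //; rewrite -ab_projV; congr ab_proj.
exact/esym/(@pres_invgE _ rels [:: gen x]).
Qed.

Lemma ab_gen_rel u v :
  rels u v -> word_sum _ _ ab_gen u = word_sum _ _ ab_gen v.
Proof.
move=> uv; rewrite -!ab_proj_word; congr ab_proj.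
by apply/class_of_wordP/pres_rel.
Qed.

(** Von Dyck's theorem for abelian targets: [word_sum] respects cancellation and, by hypothesis, the
    relations, so it is constant on the classes of [pres_eq]. *)
Lemma ab_gen_lift (B : zmodType) (phi : X -> B) :
    (forall u v, rels u v -> word_sum _ _ phi u = word_sum _ _ phi v) ->
  exists h : {additive abelianisation (presented_group rels) -> B},
    forall x, h (ab_gen x) = phi x.
Proof.
move=> phiR.
have phiE u v : pres_eq rels u v -> word_sum _ _ phi u = word_sum _ _ phi v.
  elim=> {u v} [u v /phiR //|x b|//|u v _ -> //|u v w _ -> _ -> //|].
    rewrite /word_sum big_cons big_seq1 big_nil /=.
    by case: b; rewrite /= ?addNr ?addrN.
  by move=> u u' v v' _ uE _ vE; rewrite /word_sum !big_cat /=; congr (_ + _).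
have phiC w : word_sum _ _ phi (word_of_class (class_of_word rels w))
    = word_sum _ _ phi w.
  exact/phiE/pres_word_of_class.
have [|h hE] := @ab_lift (presented_group rels) B
  (fun g => word_sum _ _ phi (word_of_class g)).
  by move=> g g'; rewrite phiC /word_sum big_cat.
by exists h => x; rewrite /ab_gen hE phiC /word_sum big_seq1.
Qed.

Lemma ab_gen_span (g : abelianisation (presented_group rels)) :
    (forall x, exists m : int, ab_gen x = g *~ m) ->
  forall a, exists m : int, a = g *~ m.
Proof.
move=> gX a; rewrite -[a]ab_reprK -[ab_repr a]word_of_classK ab_proj_word.
apply: (big_ind (fun a => exists m : int, a = g *~ m)).
- by exists 0; rewrite mulr0z.
- by move=> _ _ [m ->] [m' ->]; exists (m + m'); rewrite mulrzDr.
- move=> [x b] _ /=; have [m ->] := gX x.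
  by case: b; [exists (- m); rewrite mulrNz | exists m].
Qed.

End PresentedAbelianisation.

(** * Connected LOG groups *)

(** Once generators commute, the label cancels from each relation, which then identifies the two
    ends of the edge. Connectedness leaves a single generator, and the exponent sum shows that its
    order is infinite. *)
Lemma log_group_ab (L : log_graph) :
  log_connected L -> zmod_iso (abelianisation (log_group L)) int.
Proof.
case=> /card_gt0P [v0 _] Lc.
have [|h hE] := @ab_gen_lift (log_vertex L) (@log_rels L) int (fun=> 1).
  by move=> _ _ [e [-> ->]]; rewrite /word_sum !big_cons !big_nil /=; lia.
pose x := ab_gen _ (@log_rels L).
have xe e : x (log_terminal e) = x (log_initial e).
  have /ab_gen_rel : log_rels [:: gen_inv (log_terminal e);
    gen_inv (log_label e); gen (log_initial e); gen (log_label e)] [::].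
    by exists e.
  rewrite /word_sum !big_cons !big_nil /= addr0.
  rewrite (addrC _ (ab_gen _ _ (log_label e))).
  by rewrite addKr -/x => /eqP; rewrite addrC subr_eq0 => /eqP.
have xv v : x v = x v0.
  have /connectP [p] := Lc v v0.
  elim: p v => [|u p IHp] v /=; first by move=> _ ->.
  case/andP=> /existsP [e vu] pu /(IHp _ pu) <-.
  by case/orP: vu => /andP [/eqP <- /eqP <-]; rewrite xe.
exists h; exists (fun m => x v0 *~ m) => [a|m]; last first.
  by rewrite raddfMz hE intz.
have [m ->] : exists m : int, a = x v0 *~ m.
  by apply: ab_gen_span => v; exists 1; apply: xv.
by rewrite raddfMz hE intz.
Qed.

(** * Generators and relations of the abelianised Prishchepov group *)

Lemma dvdn_modz_mod (d n : nat) (z : int) :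
  (d %| n)%N -> ((z %% n%:Z)%Z = z %[mod d%:Z])%Z.
Proof.
move=> dn; apply/eqP; rewrite eqz_mod_dvd.
have /dvdz_trans : (d%:Z %| n%:Z)%Z by [].
by apply; rewrite -eqz_mod_dvd modz_mod.
Qed.

Lemma Z2_natr_parity (r s : nat) : odd r = odd s -> r%:R = s%:R :> 'Z_2.
Proof. by move=> rs; apply/val_inj; rewrite /= !val_Zp_nat // !modn2 rs. Qed.

Section PrishchepovAbelianisation.
Variables (r n k s q : nat) (n_gt0 : (0 < n)%N).
Let A : zmodType := abelianisation (prishchepov r n k s q).

(** The generator [x_z] for an arbitrary integer [z], so that subscripts can be added without
    reducing them; the base ordinal is the index 0. *)
Definition prishchepov_gen (z : int) : A :=
  ab_gen _ (@prishchepov_rels n r k s q) (subscript (Ordinal n_gt0) z).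

Let n_neq0 : n%:Z != 0. Proof. by rewrite -lt0n. Qed.

Lemma subscriptE (i : 'I_n) (z : int) :
  (subscript i z)%:Z = ((i%:Z + z) %% n%:Z)%Z.
Proof. by rewrite /= gez0_abs ?modz_ge0. Qed.

Lemma subscript_ord0 (i : 'I_n) : subscript (Ordinal n_gt0) i%:Z = i.
Proof.
apply/val_inj/eqP; rewrite -eqz_nat; apply/eqP.
by rewrite subscriptE add0r modz_small //= ltz_nat ltn_ord.
Qed.

Lemma subscript_add (i : 'I_n) (z : int) :
  subscript i z = subscript (Ordinal n_gt0) (i%:Z + z).
Proof.
by apply/val_inj/eqP; rewrite -eqz_nat; apply/eqP; rewrite !subscriptE add0r.
Qed.

Lemma subscript_mod (z : int) :
  subscript (Ordinal n_gt0) (z %% n%:Z)%Z = subscript (Ordinal n_gt0) z.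
Proof.
apply/val_inj/eqP; rewrite -eqz_nat; apply/eqP.
by rewrite !subscriptE !add0r modz_mod.
Qed.

Lemma prishchepov_gen_mod (z : int) :
  prishchepov_gen (z %% n%:Z)%Z = prishchepov_gen z.
Proof. by rewrite /prishchepov_gen subscript_mod. Qed.

Lemma prishchepov_gen_rel (z : int) :
  \sum_(j < r) prishchepov_gen (z + q%:Z * j%:Z) =
  \sum_(j < s) prishchepov_gen (z + q%:Z * j%:Z + (k%:Z - 1)).
Proof.
pose i := subscript (Ordinal n_gt0) z.
have := @ab_gen_rel _ (@prishchepov_rels n r k s q) _ _
  (ex_intro _ i (conj erefl erefl)).
rewrite !word_sum_gens -!(big_mkord xpredT (fun j => _ (_ + _ * j%:Z)))
  -(big_mkord xpredT (fun j => prishchepov_gen (z + q%:Z * j%:Z + (k%:Z - 1)))).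
rewrite /index_iota !subn0 => iE.
etransitivity; last (etransitivity; first exact: iE).
  apply: eq_bigr => j _; rewrite subscript_add -/(prishchepov_gen _).
  rewrite -[LHS]prishchepov_gen_mod -[RHS]prishchepov_gen_mod; congr prishchepov_gen.
  by rewrite subscriptE add0r modzDml.
apply: eq_bigr => j _; rewrite subscript_add -/(prishchepov_gen _).
rewrite -[LHS]prishchepov_gen_mod -[RHS]prishchepov_gen_mod; congr prishchepov_gen.
by rewrite subscriptE add0r modzDml addrA.
Qed.

(** Homomorphisms from [A] to [B] are given by [n]-periodic families on the integers that satisfy
    the relations. *)
Lemma prishchepov_gen_lift (B : zmodType) (Y : int -> B) :
    (forall z, Y (z %% n%:Z)%Z = Y z) ->
    (forall z, \sum_(j < r) Y (z + q%:Z * j%:Z) =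
               \sum_(j < s) Y (z + q%:Z * j%:Z + (k%:Z - 1))) ->
  exists h : {additive A -> B}, forall z, h (prishchepov_gen z) = Y z.
Proof.
move=> Ymod Yrel.
have [|h hE] := @ab_gen_lift _ (@prishchepov_rels n r k s q) B
  (fun i => Y i%:Z).
  move=> _ _ [i [-> ->]]; rewrite !word_sum_gens.
  have := Yrel i%:Z.
  rewrite -(big_mkord xpredT (fun j => Y (i%:Z + q%:Z * j%:Z)))
    -(big_mkord xpredT (fun j => Y (i%:Z + q%:Z * j%:Z + (k%:Z - 1)))).
  rewrite /index_iota !subn0 => iE.
  under eq_bigr do rewrite subscriptE Ymod.
  by rewrite iE; apply: eq_bigr => j _; rewrite subscriptE Ymod -addrA.
by exists h => z; rewrite hE subscriptE add0r Ymod.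
Qed.

Lemma prishchepov_gen_span (g : A) :
    (forall z, exists m : int, prishchepov_gen z = g *~ m) ->
  forall a, exists m : int, a = g *~ m.
Proof.
move=> gX; apply: ab_gen_span => i.
by have := gX i; rewrite /prishchepov_gen subscript_ord0.
Qed.

(** * The cyclic shift when the abelianisation is infinite cyclic *)

Section InfiniteCyclic.
Hypotheses (r_neq_s : r <> s) (A_iso : zmod_iso A int).

Lemma infinite_cyclic_gen :
  (forall z, prishchepov_gen (z + 1) = - prishchepov_gen z) /\
  (forall m : int, prishchepov_gen 0 *~ m = 0 -> m = 0).
Proof.
case: A_iso => phi [psi phiK psiK].
have phi_inj := can_inj phiK.
have phi_span a : a = psi 1 *~ phi a.
  by apply: phi_inj; rewrite raddfMz psiK intz.
(* [T] is the endomorphism of [A] induced by the shift. Since [psi 1] generates [A], [T] is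
   multiplication by the integer [t] with [T (psi 1) = t (psi 1)]. *)
have [||T TE] := prishchepov_gen_lift A (fun z => prishchepov_gen (z + 1)).
- move=> z; rewrite -[LHS]prishchepov_gen_mod -[RHS]prishchepov_gen_mod.
  by rewrite modzDml.
- move=> z; under eq_bigr do rewrite addrAC.
  rewrite prishchepov_gen_rel; apply: eq_bigr => j _.
  by congr prishchepov_gen; lia.
pose t := phi (T (psi 1)).
have shift z : prishchepov_gen (z + 1) = prishchepov_gen z *~ t.
  rewrite -TE; set a := prishchepov_gen z.
  by rewrite [in LHS](phi_span a) raddfMz (phi_span (T _)) [in RHS](phi_span a)
    -!mulrzA mulrC.
have genE (m : nat) :
  prishchepov_gen m%:Z = prishchepov_gen 0 *~ (t ^+ m).
  elim: m => [|m IHm]; first by rewrite expr0 mulr1z.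
  by rewrite -addn1 PoszD shift IHm -mulrzA addn1 exprSr.
have genE_mod z :
    prishchepov_gen z = prishchepov_gen 0 *~ (t ^+ `|(z %% n%:Z)%Z|%N).
  by rewrite -genE gez0_abs ?modz_ge0 // prishchepov_gen_mod.
have span z : exists m : int, prishchepov_gen z = prishchepov_gen 0 *~ m.
  by rewrite genE_mod; eexists.
(* Every [x_z] is a multiple of [x_0], so [x_0] spans [A]; were it zero, [psi 1] would vanish. *)
have gen0 : phi (prishchepov_gen 0) != 0.
  apply/eqP=> g0; have [m] := prishchepov_gen_span _ span (psi 1).
  by move/(congr1 phi); rewrite psiK raddfMz g0 mul0rz.
have inf m : prishchepov_gen 0 *~ m = 0 -> m = 0.
  move/(congr1 phi)/eqP; rewrite raddfMz raddf0 mulrzz mulf_eq0 (negPf gen0).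
  by move/eqP.
split=> // z; rewrite shift.
(* Compare [x_n = t^n x_0] with [x_n = x_0], using that [x_0] has infinite order. *)
have tn : t ^+ n = 1.
  apply/eqP; rewrite -subr_eq0; apply/eqP/inf.
  rewrite mulrzBr -genE mulr1z -prishchepov_gen_mod modzz.
  exact: subrr.
have t_abs : `|t|%N = 1%N.
  by apply/eqP; rewrite -(@eqn_exp2r _ 1 n) // exp1n -abszX tn.
have [t1|->] : t = 1 \/ t = -1; [lia | | by rewrite mulrN1z].
(* If [t = 1], all generators equal [x_0], and the relation reads [(r - s) x_0 = 0]. *)
case: r_neq_s; have := prishchepov_gen_rel 0.
under eq_bigr do rewrite genE_mod t1 expr1n mulr1z.
under [in RHS]eq_bigr do rewrite genE_mod t1 expr1n mulr1z.
rewrite !sumr_const !card_ord => rs.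
have : prishchepov_gen 0 *~ (r%:Z - s%:Z) = 0.
  by rewrite mulrzBr -!pmulrn rs subrr.
by move/inf; lia.
Qed.

End InfiniteCyclic.

(** * Arithmetic consequences of alternating generators *)

Section AlternatingGenerators.
Hypothesis genS : forall z, prishchepov_gen (z + 1) = - prishchepov_gen z.
Hypothesis gen0_inf : forall m : int, prishchepov_gen 0 *~ m = 0 -> m = 0.

Lemma alternating_gen_nat (m : nat) :
  prishchepov_gen m%:Z = prishchepov_gen 0 *~ (-1) ^+ m.
Proof.
elim: m => [|m IHm]; first by rewrite expr0 mulr1z.
by rewrite -addn1 PoszD genS IHm addn1 exprS mulN1r mulrNz.
Qed.

Lemma alternating_gen0_inj : injective (fun m : int => prishchepov_gen 0 *~ m).
Proof.
move=> m m' /= mm'; apply/eqP; rewrite -subr_eq0; apply/eqP/gen0_inf.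
by rewrite mulrzBr mm' subrr.
Qed.

Lemma alternating_even_n : ~~ odd n.
Proof.
have : prishchepov_gen 0 *~ ((-1) ^+ n) = prishchepov_gen 0 *~ 1.
  by rewrite -alternating_gen_nat mulr1z -prishchepov_gen_mod modzz.
by move/alternating_gen0_inj; rewrite -signr_odd; case: (odd n).
Qed.

Lemma sum_alternating (m : nat) : \sum_(j < m) (-1) ^+ j = (odd m)%:Z.
Proof.
elim: m => [|m IHm]; first by rewrite big_ord0.
by rewrite big_ord_recr /= IHm -signr_odd; case: (odd m).
Qed.

Lemma alternating_parities : r <> s -> (0 < r)%N ->
  [/\ odd q, odd r = odd s & odd s -> odd k].
Proof.
move=> r_neq_s r_gt0.
(* The relation is taken at [z = 1] so that the right-hand subscripts become [k + q * j], which are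
   natural numbers even when [k = 0]. *)
have : \sum_(j < r) (-1) ^+ (1 + q * j) =
       \sum_(j < s) (-1) ^+ (k + q * j) :> int.
  apply: alternating_gen0_inj => /=; rewrite !mulrz_sumr.
  have := prishchepov_gen_rel 1.
  under eq_bigr do rewrite -PoszM -PoszD alternating_gen_nat.
  move=> ->; apply: eq_bigr => j _.
  by rewrite -alternating_gen_nat; congr prishchepov_gen; lia.
under eq_bigr do rewrite exprD exprM -(signr_odd _ q).
under [in RHS]eq_bigr do rewrite exprD exprM -(signr_odd _ q).
rewrite -!mulr_sumr -(signr_odd _ k); case: (odd q) => /=.
  rewrite !sum_alternating.
  by case: (odd r); case: (odd s); case: (odd k).
(* For even [q] the relation reads [-r = s] or [-r = -s], according to the parity of [k]; the first
   contradicts [0 < r], the second [r <> s]. *)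
under eq_bigr do rewrite expr1n.
under [in RHS]eq_bigr do rewrite expr1n.
by rewrite !sumr_const !card_ord; case: (odd k) => /=; lia.
Qed.

(** Such a [Y] is the image of the generators under a homomorphism, which carries the identity
    [genS] along. Each choice of [Y] below turns this into a constraint on the parameters or on
    another group. *)
Lemma alternating_gen_lift (B : zmodType) (Y : int -> B) :
    (forall z, Y (z %% n%:Z)%Z = Y z) ->
    (forall z, \sum_(j < r) Y (z + q%:Z * j%:Z) =
               \sum_(j < s) Y (z + q%:Z * j%:Z + (k%:Z - 1))) ->
  forall z, Y (z + 1) = - Y z.
Proof.
move=> Ymod Yrel z; have [h hE] := prishchepov_gen_lift _ _ Ymod Yrel.
by rewrite -!hE genS raddfN.
Qed.

Lemma alternating_diff : r <> s -> (0 < r)%N -> `|r%:Z - s%:Z|%N = 2%N.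
Proof.
move=> r_neq_s r_gt0; set m := `|_|%N.
have [_ rs _] := alternating_parities r_neq_s r_gt0.
(* Equal parity and [r <> s] give [m >= 2], the range in which ['Z_m] really is the ring of integers
   modulo [m]. *)
have m_gt1 : (1 < m)%N by lia.
have rsm : r%:R = s%:R :> 'Z_m.
  apply/val_inj; rewrite /= !val_Zp_nat //; apply/eqP.
  case: (leqP r s) => [|/ltnW] le_rs; [rewrite eq_sym|]; rewrite eqn_mod_dvd //.
    by have -> : m = (s - r)%N by rewrite /m; lia.
  by have -> : m = (r - s)%N by rewrite /m; lia.
have /(_ 0)/eqP : forall z : int, (1 : 'Z_m) = - 1.
  by apply: alternating_gen_lift => // z; rewrite !sumr_const !card_ord.
rewrite -addr_eq0 -(natrD _ 1 1) => /eqP/(congr1 val).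
rewrite [LHS](val_Zp_nat m_gt1 2) => /eqP m2.
have := @dvdn_leq m 2 isT m2; lia.
Qed.

Lemma alternating_gcd : odd r = odd s -> gcdz (gcdz n%:Z (k%:Z - 1)) q%:Z = 1.
Proof.
move=> rs; set d := gcdz _ _.
have dn : (d %| n%:Z)%Z by apply: dvdz_trans (dvdz_gcdl _ _) (dvdz_gcdl _ _).
have dk : (d %| k%:Z - 1)%Z.
  by apply: dvdz_trans (dvdz_gcdl _ _) (dvdz_gcdr _ _).
have dq : (d %| q%:Z)%Z by apply: dvdz_gcdr.
have rs2 := Z2_natr_parity r s rs.
(* All subscripts within one relation are congruent modulo [d], so the relation for this indicator
   is [r Y(z) = s Y(z)], true modulo 2 by parity. *)
pose Y z : 'Z_2 := (d %| z)%Z%:R.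
have YD z w : (d %| w)%Z -> Y (z + w) = Y z.
  by move=> dw; rewrite /Y (rpredDr z dw).
have /(_ 0) : forall z, Y (z + 1) = - Y z.
  apply: alternating_gen_lift => z.
    by rewrite [in RHS](divz_eq z n%:Z) addrC [RHS]YD // dvdz_mull.
  under eq_bigr do rewrite YD ?dvdz_mulr //.
  under [in RHS]eq_bigr do rewrite !YD ?dvdz_mulr //.
  by rewrite !sumr_const !card_ord -mulr_natr rs2 mulr_natr.
(* Since [Y 0 = 1], alternation forces [Y 1] to be nonzero, that is, [d] divides 1. *)
rewrite /Y add0r dvdz0; case: (boolP (d %| 1)%Z) => // d1 _.
have /= := d1; rewrite dvdz1 /d /gcdz /= => /eqP ->.
by [].
Qed.

End AlternatingGenerators.

End PrishchepovAbelianisation.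

(** * Passing to an odd number of generators *)

(** Going once round an odd cycle gives [x_0 = x_c = - x_0], so all generators equal one element
    killed by 2. It is nonzero because sending every generator to 1 in ['Z_2] respects the relations
    when [r] and [s] have equal parity. *)
Lemma prishchepov_ab_Z2 (r c k s q : nat) (c_gt0 : (0 < c)%N) :
    odd c -> odd r = odd s ->
    (forall z, prishchepov_gen r c k s q c_gt0 (z + 1) =
               - prishchepov_gen r c k s q c_gt0 z) ->
  zmod_iso (abelianisation (prishchepov r c k s q)) 'Z_2.
Proof.
set X := prishchepov_gen r c k s q c_gt0 => c_odd rs XS.
have Xnat := alternating_gen_nat _ _ _ _ _ _ XS; rewrite -/X in Xnat.
have X0N : - X 0 = X 0.
  have := Xnat c; rewrite -signr_odd c_odd mulrN1z => <-.
  by rewrite /X -prishchepov_gen_mod modzz.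
have XE z : X z = X 0.
  rewrite /X -prishchepov_gen_mod -[(z %% _)%Z]gez0_abs ?modz_ge0 -?lt0n //.
  by rewrite -/X Xnat -signr_odd; case: odd; rewrite ?mulrN1z ?mulr1z.
have X2 : X 0 *+ 2 = 0 by rewrite mulr2n -{1}X0N addNr.
have rs2 := Z2_natr_parity r s rs.
have [//||h hE] := prishchepov_gen_lift r c k s q c_gt0 'Z_2 (fun=> 1).
  by move=> z; rewrite !sumr_const !card_ord.
(* The inverse map multiplies [X 0] by the residue's representative 0 or 1; reduction modulo 2 is
   harmless because [X2] holds. *)
have XZ2 (m : nat) : X 0 *+ (m%:R : 'Z_2)%R = X 0 *+ m.
  rewrite val_Zp_nat // [in RHS](divn_eq m 2) mulrnDr mulnC mulrnA X2 mul0rn.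
  by rewrite add0r.
exists h; exists (fun x : 'Z_2 => X 0 *+ x) => [a|x]; last first.
  by rewrite raddfMn hE natr_Zp.
have [m ->] : exists m : nat, a = X 0 *+ m.
  have [|m ->] := prishchepov_gen_span r c k s q c_gt0 (X 0) _ a.
    by move=> z; exists 1; apply: XE.
  case: (intP m) => [|{}m|{}m]; [by exists 0%N|by exists m.+1|].
  by exists m.+1; rewrite mulrNz -mulNrz X0N.
by rewrite raddfMn hE XZ2.
Qed.

Lemma largest_odd_divisorP (n : nat) : (0 < n)%N ->
  odd (largest_odd_divisor n) && (largest_odd_divisor n %| n)%N.
Proof.
move=> n_gt0; set c := largest_odd_divisor n.
(* An empty maximum would default to 0; the odd divisor 1 excludes this value. *)
have : (1 <= c)%N.
  by apply: (@leq_bigmax_seq _ _ _ id 1%N) => //; rewrite -dvdn_divisors ?dvd1n.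
suff /orP[/eqP -> //|//] : (c == 0%N) || (odd c && (c %| n)%N).
rewrite /c /largest_odd_divisor big_seq_cond.
apply: (big_ind (fun c => (c == 0%N) || (odd c && (c %| n)%N))) => //.
  by move=> x y Px Py; rewrite /maxn; case: ltnP.
by move=> d; rewrite -dvdn_divisors // => /andP[-> ->]; rewrite orbT.
Qed.

Theorem corollary6p4 (r n k s q : nat)
    (n_ge1 : (1 <= n)%N) (k_lt_n : (k < n)%N) (q_lt_n : (q < n)%N)
    (r_ge1 : (1 <= r)%N) (s_ge1 : (1 <= s)%N) (r_neq_s : r <> s) :
  (connected_log_group (prishchepov r n k s q) ->
     zmod_iso (abelianisation (prishchepov r n k s q)) int) /\
  (zmod_iso (abelianisation (prishchepov r n k s q)) int ->
     ~~ odd n /\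
     gcdz (gcdz n%:Z (k%:Z - 1)) q%:Z = 1%:Z /\
     `|r%:Z - s%:Z|%N = 2%N /\
     odd q /\
     zmod_iso (abelianisation
                 (prishchepov r (largest_odd_divisor n) k s q)) 'Z_2 /\
     (~~ odd s \/ (odd s /\ odd k))).
Proof.
split=> [[L [Lc /group_iso_ab GL]]|A_iso].
  exact: zmod_iso_trans GL (log_group_ab _ Lc).
have [XS X_inf] := infinite_cyclic_gen _ _ _ _ _ n_ge1 r_neq_s A_iso.
have [q_odd rs sk] := alternating_parities _ _ _ _ _ _ XS X_inf r_neq_s r_ge1.
split; first exact: alternating_even_n XS X_inf.
split; first exact: alternating_gcd XS rs.
split; first exact: alternating_diff XS X_inf r_neq_s r_ge1.
split=> //; split; last first.
  by case: (odd s) sk => sk; [right; split=> //; apply: sk | left].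
have /andP[c_odd c_dvd] := largest_odd_divisorP _ n_ge1.
have c_gt0 := odd_gt0 c_odd; set c := largest_odd_divisor n in c_odd c_dvd c_gt0 *.
apply: (prishchepov_ab_Z2 _ _ _ _ _ c_gt0) => //.
(* Here [Y] is the family of generators of the group with [c] generators: it is [c]-periodic, hence
   [n]-periodic as [c] divides [n], and satisfies relations of the same form. *)
apply: (alternating_gen_lift _ _ _ _ _ _ XS) => z; last first.
  exact: prishchepov_gen_rel.
by rewrite -prishchepov_gen_mod dvdn_modz_mod ?prishchepov_gen_mod.
Qed.
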